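(* Let $\beta_0,\beta_1>0$ and consider the active magnetic bearing (AMB) dynamics $$\dot x_1=x_2,\qquad \dot x_2=\beta_0x_3+\beta_1x_3|x_3|,\qquad \dot x_3=u,$$ with state $x=(x_1,x_2,x_3)\in\mathbb{R}^3$ and control input $u\in\mathbb{R}$. Let $c_1,c_2>0$ and $0<\delta\le\min\{4/3,c_1\}$, let $\mu$ and $V$ be the functions on $\mathbb{R}^3$ (depending on $c_1,c_2,\delta$) defined in the context, and set $$X_3=\beta_0x_3+\beta_1x_3|x_3|,\qquad u(x)=\frac{\mu(x_1,x_2,X_3)}{\beta_0+2\beta_1|x_3|}.$$ Then the control law $u(x)$ in closed loop with the AMB dynamics ensures that $x=0$ is globally asymptotically stable (GAS), and it has arbitrarily small amplitude: for every $\varepsilon>0$ the parameters $c_1,c_2,\delta$ (subject to the constraints above) can be chosen so that $|u(x)|\le\varepsilon$ for all $x\in\mathbb{R}^3$. Moreover, the function $x\mapsto V(x_1,x_2,X_3)$ is a control-Lyapunov function (CLF) for the AMB dynamics.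
   Context: $\sigma:\mathbb{R}\to[-1,1]$ is the standard saturation: $\sigma(s)=s$ if $|s|\le1$ and $\sigma(s)=\mathrm{sign}(s)$ otherwise. For $(\xi_1,\xi_2,\xi_3)\in\mathbb{R}^3$ put $$z_1=\delta(c_1\xi_1+\xi_2)+\frac{\delta}{c_1}\xi_3,\qquad z_2=c_1\xi_2+\xi_3,\qquad z_3=\xi_3,$$ $$U(z_2,z_3)=\frac12 z_3^2+\int_0^{z_2}\sigma(s)\,ds,$$ $$g(z_1,z_2,z_3)=\frac{\delta}{c_1}\sigma(z_1)+4\bigl(1+U(z_2,z_3)\bigr)\bigl(z_3+\sigma(z_2)\bigr)-\frac{\delta}{2}(z_2+z_3).$$ The functions $\mu$ and $V$ are $$\mu(\xi_1,\xi_2,\xi_3)=-c_1\sigma(z_2)-c_2\,\sigma\bigl(g(z_1,z_2,z_3)\bigr),$$ $$V(\xi_1,\xi_2,\xi_3)=4U(z_2,z_3)+2U^2(z_2,z_3)-\frac{\delta}{2}z_2z_3+\int_0^{z_1}\sigma(s)\,ds.$$ For a control system $\dot x=F(x,u)$ on $\mathbb{R}^3$ with scalar input $u$ and a feedback $u(x)$, the origin is called GAS for the closed-loop system $\dot x=F(x,u(x))$ if there is a continuously differentiable function $W:\mathbb{R}^3\to[0,\infty)$ that is radially unbounded ($W(x)\to\infty$ as $|x|\to\infty$) and zero only at the origin, and whose derivative $\dot W(x)=\nabla W(x)\cdot F(x,u(x))$ along the closed-loop trajectories is negative definite (zero at $x=0$ and strictly negative for all $x\neq0$). A function $W$ satisfying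 these requirements for some feedback $u(x)$ is called a CLF for $\dot x=F(x,u)$. In the physical model, $\beta_0=2\bar\Phi_0/(m\mu_0A)$ and $\beta_1=1/(m\mu_0A)$, where $m$ is the rotor mass, $\mu_0$ the permeability of air, $A$ the electromagnet cross-sectional area, and $\bar\Phi_0$ a constant determined by the bias flux and the initial control fluxes; only $\beta_0,\beta_1>0$ matters for the statement. *)

(* Defs.v *)
From Stdlib Require Import Reals.
From Coquelicot Require Import Coquelicot.
Open Scope R_scope.

(* With Coquelicot's product structures, [norm] on R3 is the Euclidean norm. *)
Notation R3 := (R * R * R)%type.

Definition partial1 (W : R3 -> R) (x : R3) : R :=
  let '(x1, x2, x3) := x in Derive (fun t => W (t, x2, x3)) x1.
Definition partial2 (W : R3 -> R) (x : R3) : R :=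
  let '(x1, x2, x3) := x in Derive (fun t => W (x1, t, x3)) x2.
Definition partial3 (W : R3 -> R) (x : R3) : R :=
  let '(x1, x2, x3) := x in Derive (fun t => W (x1, x2, t)) x3.

Definition continuously_differentiable (W : R3 -> R) : Prop :=
  (forall x1 x2 x3 : R,
     ex_derive (fun t => W (t, x2, x3)) x1 /\
     ex_derive (fun t => W (x1, t, x3)) x2 /\
     ex_derive (fun t => W (x1, x2, t)) x3) /\
  (forall x : R3,
     continuous (partial1 W) x /\
     continuous (partial2 W) x /\
     continuous (partial3 W) x).

Definition radially_unbounded (W : R3 -> R) : Prop :=
  forall M : R, exists r : R, forall x : R3, r < norm x -> M < W x.

Definition Wdot (F : R3 -> R -> R3) (u W : R3 -> R) (x : R3) : R :=
  let '(f1, f2, f3) := F x (u x) in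
  partial1 W x * f1 + partial2 W x * f2 + partial3 W x * f3.

Definition negative_definite (f : R3 -> R) : Prop :=
  f (0, 0, 0) = 0 /\ forall x : R3, x <> (0, 0, 0) -> f x < 0.

Definition lyapunov_for (F : R3 -> R -> R3) (u W : R3 -> R) : Prop :=
  continuously_differentiable W /\
  (forall x : R3, 0 <= W x) /\
  radially_unbounded W /\
  (forall x : R3, W x = 0 <-> x = (0, 0, 0)) /\
  negative_definite (Wdot F u W).

Definition GAS (F : R3 -> R -> R3) (u : R3 -> R) : Prop :=
  exists W : R3 -> R, lyapunov_for F u W.

Definition CLF (F : R3 -> R -> R3) (W : R3 -> R) : Prop :=
  exists u : R3 -> R, lyapunov_for F u W.

Definition sat (s : R) : R := if Rle_dec (Rabs s) 1 then s else sign s.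

Definition z1 (c1 delta : R) (xi : R3) : R :=
  let '(xi1, xi2, xi3) := xi in
  delta * (c1 * xi1 + xi2) + delta / c1 * xi3.
Definition z2 (c1 : R) (xi : R3) : R :=
  let '(_, xi2, xi3) := xi in c1 * xi2 + xi3.
Definition z3 (xi : R3) : R :=
  let '(_, _, xi3) := xi in xi3.

Definition U (y2 y3 : R) : R := / 2 * y3 ^ 2 + RInt sat 0 y2.

Definition g (c1 delta y1 y2 y3 : R) : R :=
  delta / c1 * sat y1 + 4 * (1 + U y2 y3) * (y3 + sat y2)
  - delta / 2 * (y2 + y3).

Definition mu (c1 c2 delta : R) (xi : R3) : R :=
  - c1 * sat (z2 c1 xi)
  - c2 * sat (g c1 delta (z1 c1 delta xi) (z2 c1 xi) (z3 xi)).

Definition V (c1 delta : R) (xi : R3) : R :=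
  4 * U (z2 c1 xi) (z3 xi) + 2 * (U (z2 c1 xi) (z3 xi)) ^ 2
  - delta / 2 * z2 c1 xi * z3 xi + RInt sat 0 (z1 c1 delta xi).

Definition X3 (beta0 beta1 x3 : R) : R := beta0 * x3 + beta1 * x3 * Rabs x3.

Definition amb (beta0 beta1 : R) (x : R3) (u : R) : R3 :=
  let '(x1, x2, x3) := x in
  (x2, beta0 * x3 + beta1 * x3 * Rabs x3, u).

Definition amb_control (beta0 beta1 c1 c2 delta : R) (x : R3) : R :=
  let '(x1, x2, x3) := x in
  mu c1 c2 delta (x1, x2, X3 beta0 beta1 x3)
  / (beta0 + 2 * beta1 * Rabs x3).

Definition amb_clf (beta0 beta1 c1 delta : R) (x : R3) : R :=
  let '(x1, x2, x3) := x in V c1 delta (x1, x2, X3 beta0 beta1 x3).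

Definition admissible (c1 c2 delta : R) : Prop :=
  0 < c1 /\ 0 < c2 /\ 0 < delta /\ delta <= Rmin (4 / 3) c1.

(* Main.v *)
Require Import Defs.
From Stdlib Require Import Reals Lra Psatz.
From Coquelicot Require Import Coquelicot.
Open Scope R_scope.

(* In the coordinates [xi = (x1, x2, X3 x3)] the closed loop is a triple
   integrator driven by [mu], and [g] is the derivative of [V] with respect to
   [xi3].  Writing [si] for [sat zi], the derivative of [V] along it is
     [- c2 g sat(g) - 4 c1 (1 + U) s2^2 + c1 delta/2 s2 (z2 + z3)
      - c1 delta/2 z3^2 + delta s1 (z2 - s2)].
   The growth of [U] in [z2] absorbs the indefinite terms, which leaves at most
   [- c2 g sat(g) - c1 s2^2 - c1 delta/4 z3^2]; when [z2 = z3 = 0], [g] reduces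
   to a multiple of [sat z1]. *)

(** * The saturation and its primitive *)

(** Twice the primitive of [Rabs] vanishing at 0. Both the integral of [sat] and the map [X3] are
    built from it. *)
Definition signed_square (t : R) : R := t * Rabs t.

(** The first-order remainder is at most [h ^ 2] for all signs of [x] and [x + h], so the kink of
    [Rabs] needs no separate treatment. The difference quotient is then off by at most [Rabs h], and
    [eps] itself serves as radius. *)
Lemma is_derive_signed_square (x : R) : is_derive signed_square x (2 * Rabs x).
Proof.
  unfold signed_square. apply is_derive_Reals. intros eps heps.
  exists (mkposreal eps heps). intros h hh hlt. simpl in hlt.
  assert (hnum : Rabs ((x + h) * Rabs (x + h) - x * Rabs x - 2 * Rabs x * h) <= h ^ 2).
  { apply Rabs_le.
    destruct (Rcase_abs (x + h)) as [h1|h1]; destruct (Rcase_abs x) as [h2|h2];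
      rewrite ?(Rabs_left _ h1), ?(Rabs_right _ h1), ?(Rabs_left _ h2), ?(Rabs_right _ h2);
      split; nra. }
  replace (((x + h) * Rabs (x + h) - x * Rabs x) / h - 2 * Rabs x)
    with (((x + h) * Rabs (x + h) - x * Rabs x - 2 * Rabs x * h) / h) by (field; assumption).
  rewrite Rabs_div by assumption.
  apply Rle_lt_trans with (2 := hlt).
  assert (hp := Rabs_pos_lt _ hh).
  apply Rle_div_l; [exact hp|].
  replace (Rabs h * Rabs h) with (h ^ 2); [exact hnum|].
  rewrite <- (pow2_abs h). ring.
Qed.

(** Closed form of the integral of [sat] from 0 to [y]; the constant [- 2] makes it vanish at 0. *)
Definition sat_primitive (y : R) : R :=
  (signed_square (y + 1) - signed_square (y - 1) - 2) / 4.

(** This form has no case split, so continuity and a primitive can be read off from those of [Rabs]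
    and [signed_square]. *)
Lemma sat_Rabs (s : R) : sat s = (Rabs (s + 1) - Rabs (s - 1)) / 2.
Proof.
  unfold sat. destruct (Rle_dec (Rabs s) 1) as [h|h].
  - apply Rabs_le_between in h.
    rewrite Rabs_pos_eq, Rabs_left1 by lra. lra.
  - destruct (Rle_or_lt 0 s) as [h0|h0].
    + rewrite Rabs_pos_eq in h by lra.
      rewrite sign_eq_1, !Rabs_pos_eq by lra. lra.
    + rewrite Rabs_left in h by lra.
      rewrite sign_eq_m1, !Rabs_left by lra. lra.
Qed.

(** Indexed by both values, so that one [destruct] replaces [sat s] and [sat_primitive s] together
    by polynomials in each zone. *)
Variant sat_spec (s : R) : R -> R -> Prop :=
  | SatLinear : -1 <= s <= 1 -> sat_spec s s (s ^ 2 / 2)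
  | SatHigh : 1 < s -> sat_spec s 1 (s - / 2)
  | SatLow : s < -1 -> sat_spec s (-1) (- s - / 2).

Lemma satP (s : R) : sat_spec s (sat s) (sat_primitive s).
Proof.
  rewrite sat_Rabs. unfold sat_primitive, signed_square.
  destruct (Rlt_or_le 1 s) as [h1|h1]; [|destruct (Rlt_or_le s (-1)) as [h2|h2]].
  - rewrite !Rabs_pos_eq by lra.
    match goal with |- sat_spec _ ?a ?b =>
      replace a with 1 by lra; replace b with (s - / 2) by lra end.
    now constructor.
  - rewrite !Rabs_left by lra.
    match goal with |- sat_spec _ ?a ?b =>
      replace a with (-1) by lra; replace b with (- s - / 2) by lra end.
    now constructor.
  - rewrite (Rabs_pos_eq (s + 1)), (Rabs_left1 (s - 1)) by lra.
    match goal with |- sat_spec _ ?a ?b =>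
      replace a with s by lra; replace b with (s ^ 2 / 2) by lra end.
    now constructor.
Qed.

Lemma is_derive_sat_primitive (y : R) : is_derive sat_primitive y (sat y).
Proof.
  rewrite sat_Rabs. unfold sat_primitive.
  assert (hp := is_derive_signed_square (y + 1)).
  assert (hm := is_derive_signed_square (y - 1)).
  auto_derive.
  - split; [eexists; exact hp|split; [eexists; exact hm|exact I]].
  - change (fun x => signed_square x) with signed_square.
    rewrite (is_derive_unique _ _ _ hp).
    replace (y + - (1)) with (y - 1) by ring.
    rewrite (is_derive_unique _ _ _ hm). field.
Qed.

Lemma continuous_sat (y : R) : continuous sat y.
Proof.
  apply (continuous_ext (fun s => (Rabs (s + 1) - Rabs (s - 1)) / 2)).
  { intros s. now rewrite sat_Rabs. }
  apply (continuous_scal_l (K := R_AbsRing) (V := R_NormedModule)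
           (fun s => Rabs (s + 1) - Rabs (s - 1)) (/ 2)).
  apply (continuous_minus (K := R_AbsRing) (V := R_NormedModule)
           (fun s => Rabs (s + 1)) (fun s => Rabs (s - 1))).
  - apply continuous_comp; [|apply continuous_Rabs].
    apply (continuous_plus (V := R_NormedModule)); [apply continuous_id|apply continuous_const].
  - apply continuous_comp; [|apply continuous_Rabs].
    apply (continuous_minus (V := R_NormedModule)); [apply continuous_id|apply continuous_const].
Qed.

Lemma RInt_sat (y : R) : RInt sat 0 y = sat_primitive y.
Proof.
  apply is_RInt_unique.
  replace (sat_primitive y) with (minus (sat_primitive y) (sat_primitive 0)).
  - apply (is_RInt_derive sat_primitive sat).
    + intros x _. apply is_derive_sat_primitive.
    + intros x _. apply continuous_sat.
  - assert (h0 : sat_primitive 0 = 0) by (destruct (satP 0); lra).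
    rewrite h0. apply (minus_zero_r (G := R_AbelianGroup)).
Qed.

Lemma U_eq (y2 y3 : R) : U y2 y3 = y3 ^ 2 / 2 + sat_primitive y2.
Proof. unfold U. rewrite RInt_sat. field. Qed.

Lemma sat_zero : sat 0 = 0.
Proof. destruct (satP 0); lra. Qed.

Lemma sat_Rabs_le (s : R) : Rabs (sat s) <= 1.
Proof. apply Rabs_le. destruct (satP s); lra. Qed.

Lemma mul_sat_ge0 (s : R) : 0 <= s * sat s.
Proof. destruct (satP s); nra. Qed.

Lemma mul_sat_eq0 (s : R) : s * sat s = 0 -> s = 0.
Proof. destruct (satP s); nra. Qed.

Lemma sat_primitive_ge0 (y : R) : 0 <= sat_primitive y.
Proof. destruct (satP y); nra. Qed.

Lemma sat_primitive_eq0 (y : R) : sat_primitive y = 0 -> y = 0.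
Proof. destruct (satP y); nra. Qed.

(** Equality holds in the saturated zones; in the linear zone this is [(Rabs y - 1) ^ 2 >= 0]. It
    makes the integral terms of [V] coercive. *)
Lemma Rabs_le_sat_primitive (y : R) : Rabs y <= sat_primitive y + / 2.
Proof. apply Rabs_le. destruct (satP y); split; nra. Qed.

(** * Estimates absorbing the indefinite terms of [V] and of its derivative *)

(** The coefficient 3, instead of the 4 available in [V], keeps one copy of [U] as a positive
    definite remainder. In the linear zone the mixed product is bounded by squares; in the saturated
    zones the term [2 * U ^ 2] is needed, since [U] is only linear in [y2]. *)
Lemma mixed_term_le (d y2 y3 : R) :
  0 < d <= 4 / 3 -> d / 2 * y2 * y3 <= 3 * U y2 y3 + 2 * U y2 y3 ^ 2.
Proof.
  intros hd. rewrite U_eq. destruct (satP y2) as [h|h|h].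
  - assert (0 <= (y2 - y3) ^ 2) by apply pow2_ge_0.
    assert (0 <= (y2 + y3) ^ 2) by apply pow2_ge_0.
    assert (d / 2 * y2 * y3 <= d / 4 * (y2 ^ 2 + y3 ^ 2)) by nra.
    assert (0 <= (y3 ^ 2 / 2 + y2 ^ 2 / 2) ^ 2) by apply pow2_ge_0.
    nra.
  (* [p] is the value of [sat_primitive y2] here. Since [p > / 2], [y2 = p + / 2] is below [2 * p],
     and [d / 2 <= 2 / 3] gives the factor [4 / 3]. *)
  - set (p := y2 - / 2). assert (hy : y2 = p + / 2) by (unfold p; lra).
    assert (hp : / 2 < p) by (unfold p; lra). clearbody p. subst y2.
    assert (d / 2 * (p + / 2) * y3 <= 4 / 3 * p * Rabs y3).
    { assert (0 <= Rabs y3) by apply Rabs_pos. assert (y3 <= Rabs y3) by apply Rle_abs.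
      assert (d / 2 * (p + / 2) <= 4 / 3 * p) by nra.
      assert (0 < d / 2 * (p + / 2)) by nra. nra. }
    (* The quadratic in [a] below has negative discriminant; its product with [p] collects the terms
       of the difference that are not visibly nonnegative. *)
    rewrite <- (pow2_abs y3). set (a := Rabs y3) in *.
    assert (0 <= p * (2 * a ^ 2 - 4 / 3 * a + 3)) by (apply Rmult_le_pos; nra).
    assert (0 <= a ^ 2) by nra. assert (0 <= (a ^ 2) ^ 2) by nra. nra.
  - set (p := - y2 - / 2). assert (hy : y2 = - (p + / 2)) by (unfold p; lra).
    assert (hp : / 2 < p) by (unfold p; lra). clearbody p. subst y2.
    assert (d / 2 * - (p + / 2) * y3 <= 4 / 3 * p * Rabs y3).
    { assert (0 <= Rabs y3) by apply Rabs_pos.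
      assert (- y3 <= Rabs y3) by (rewrite <- Rabs_Ropp; apply Rle_abs).
      assert (d / 2 * (p + / 2) <= 4 / 3 * p) by nra.
      assert (0 < d / 2 * (p + / 2)) by nra. nra. }
    rewrite <- (pow2_abs y3). set (a := Rabs y3) in *.
    assert (0 <= p * (2 * a ^ 2 - 4 / 3 * a + 3)) by (apply Rmult_le_pos; nra).
    assert (0 <= a ^ 2) by nra. assert (0 <= (a ^ 2) ^ 2) by nra. nra.
Qed.

Lemma V_lower_bound (c1 d : R) (xi : R3) :
  0 < d <= 4 / 3 ->
  z3 xi ^ 2 / 2 + sat_primitive (z2 c1 xi) + sat_primitive (z1 c1 d xi) <= V c1 d xi.
Proof.
  intros hd. unfold V. rewrite RInt_sat.
  assert (h := mixed_term_le d (z2 c1 xi) (z3 xi) hd).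
  rewrite <- U_eq. lra.
Qed.

(** In the linear zone [y2 - sat y2] vanishes and [sat y2 ^ 2] controls the rest. In the saturated
    zones [sat y2 ^ 2 = 1], and the linear growth of [U] in [y2] dominates the left side. *)
Lemma indefinite_terms_bound (c1 d y1 y2 y3 : R) :
  0 < c1 -> 0 < d <= 4 / 3 -> d <= c1 ->
  c1 * d / 2 * sat y2 * (y2 + y3) + d * sat y1 * (y2 - sat y2)
  <= 4 * c1 * (1 + U y2 y3) * sat y2 ^ 2 - c1 * sat y2 ^ 2 + c1 * d / 4 * y3 ^ 2.
Proof.
  intros hc hd hdc. rewrite U_eq.
  (* Only the bound on [sat y1] matters, so it becomes an arbitrary number in [-1, 1]. *)
  assert (hs1 := sat_Rabs_le y1). apply Rabs_le_between in hs1.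
  revert hs1. generalize (sat y1). intros s1 hs1.
  destruct (satP y2) as [h|h|h].
  - assert (0 <= y2 ^ 2) by nra. assert (0 <= y3 ^ 2) by nra.
    assert (0 <= c1 * d / 4 * (y2 - y3) ^ 2).
    { apply Rmult_le_pos; [nra|apply pow2_ge_0]. }
    assert (c1 * d * y2 ^ 2 <= c1 * (4 / 3) * y2 ^ 2).
    { apply Rmult_le_compat_r; nra. }
    assert (0 <= c1 * ((y3 ^ 2 / 2 + y2 ^ 2 / 2) * y2 ^ 2)).
    { apply Rmult_le_pos; [lra|]. apply Rmult_le_pos; lra. }
    nra.
  (* The constraint [d <= c1] enters here, to compare the [s1] term with [c1 * (y2 - 1)]. *)
  - assert (d * s1 <= c1) by nra.
    assert (d * s1 * (y2 - 1) <= c1 * (y2 - 1)) by nra.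
    assert (0 <= c1 * d / 4 * (1 - y3) ^ 2).
    { apply Rmult_le_pos; [nra|apply pow2_ge_0]. }
    assert (c1 * d * (2 * y2 + 1) <= c1 * (4 / 3) * (2 * y2 + 1)).
    { apply Rmult_le_compat_r; nra. }
    assert (0 <= c1 * y3 ^ 2) by (apply Rmult_le_pos; nra).
    assert (0 < c1 * (y2 - 1)) by nra.
    nra.
  - assert (- d * s1 <= c1) by nra.
    assert (d * s1 * (y2 + 1) <= c1 * (- y2 - 1)) by nra.
    assert (0 <= c1 * d / 4 * (1 + y3) ^ 2).
    { apply Rmult_le_pos; [nra|apply pow2_ge_0]. }
    assert (c1 * d * (2 * - y2 + 1) <= c1 * (4 / 3) * (2 * - y2 + 1)).
    { apply Rmult_le_compat_r; nra. }
    assert (0 <= c1 * y3 ^ 2) by (apply Rmult_le_pos; nra).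
    assert (0 < c1 * (- y2 - 1)) by nra.
    nra.
Qed.

(** * Decrease of [V] along the triple integrator *)

(** The gradient of [V] in the coordinates [xi] is given in closed form, so that the decrease is a
    purely algebraic statement; [is_derive_amb_clf] relates it to actual derivatives. *)
Definition V_partial1 (c1 d : R) (xi : R3) : R := d * c1 * sat (z1 c1 d xi).

Definition V_partial2 (c1 d : R) (xi : R3) : R :=
  4 * (1 + U (z2 c1 xi) (z3 xi)) * (c1 * sat (z2 c1 xi))
  - d / 2 * (c1 * z3 xi) + d * sat (z1 c1 d xi).

Definition V_partial3 (c1 d : R) (xi : R3) : R :=
  g c1 d (z1 c1 d xi) (z2 c1 xi) (z3 xi).

(** The part [- c1 * sat z2] of [mu] is chosen so that its product with [g] cancels the term
    [4 * c1 * (1 + U) * sat z2 * z3] coming from [V_partial2]. What remains indefinite is handled by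
    [indefinite_terms_bound]. *)
Lemma V_decrease (c1 c2 d xi1 xi2 xi3 : R) :
  let xi := (xi1, xi2, xi3) in
  let gv := V_partial3 c1 d xi in
  0 < c1 -> 0 < d <= 4 / 3 -> d <= c1 ->
  V_partial1 c1 d xi * xi2 + V_partial2 c1 d xi * xi3 + gv * mu c1 c2 d xi
  <= - (c2 * (gv * sat gv) + c1 * sat (z2 c1 xi) ^ 2 + c1 * d / 4 * xi3 ^ 2).
Proof.
  intros xi gv hc hd hdc.
  assert (h := indefinite_terms_bound c1 d (z1 c1 d xi) (z2 c1 xi) (z3 xi) hc hd hdc).
  unfold mu. fold (V_partial3 c1 d xi). fold gv.
  assert (hg : gv = g c1 d (z1 c1 d xi) (z2 c1 xi) (z3 xi)) by reflexivity.
  unfold V_partial1, V_partial2.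
  assert (h2 : xi2 = (z2 c1 xi - z3 xi) / c1) by (simpl; field; lra).
  assert (h3 : xi3 = z3 xi) by reflexivity.
  rewrite h2, h3. clear h2 h3.
  set (G := sat gv) in *.
  set (y1 := z1 c1 d xi) in *. set (y2 := z2 c1 xi) in *. set (y3 := z3 xi) in *.
  assert (e : gv * (- c1 * sat y2 - c2 * G) = - c2 * (gv * G) - c1 * sat y2 * gv) by ring.
  (* Only the [gv] multiplied by [c1 * sat y2] is expanded; the product [gv * G] stays opaque
     because the bound contains it too. *)
  rewrite e. clear e. rewrite hg at 2. unfold g.
  match goal with |- ?L <= ?Rr => assert (e : L =
    - c2 * (gv * G) - 4 * c1 * (1 + U y2 y3) * sat y2 ^ 2
    + c1 * d / 2 * sat y2 * (y2 + y3) - c1 * d / 2 * y3 ^ 2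
    + d * sat y1 * (y2 - sat y2)) by (field; lra) end.
  rewrite e. lra.
Qed.

(** If the derivative were nonnegative, each of the three nonnegative terms in [V_decrease] would
    vanish. This forces in turn [xi3], [z2] and [z1] to be 0, and the triangular form of these
    functions gives the origin. *)
Lemma V_decrease_strict (c1 c2 d xi1 xi2 xi3 : R) :
  let xi := (xi1, xi2, xi3) in
  0 < c1 -> 0 < c2 -> 0 < d <= 4 / 3 -> d <= c1 ->
  xi <> (0, 0, 0) ->
  V_partial1 c1 d xi * xi2 + V_partial2 c1 d xi * xi3
  + V_partial3 c1 d xi * mu c1 c2 d xi < 0.
Proof.
  intros xi hc hc2 hd hdc hxi.
  assert (h := V_decrease c1 c2 d xi1 xi2 xi3 hc hd hdc). fold xi in h. cbv zeta in h.
  destruct (Rlt_or_le (V_partial1 c1 d xi * xi2 + V_partial2 c1 d xi * xi3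
    + V_partial3 c1 d xi * mu c1 c2 d xi) 0) as [hlt|hge]; [exact hlt|exfalso].
  assert (k1 : 0 <= c2 * (V_partial3 c1 d xi * sat (V_partial3 c1 d xi)))
    by (apply Rmult_le_pos; [lra|apply mul_sat_ge0]).
  assert (k2 : 0 <= c1 * sat (z2 c1 xi) ^ 2)
    by (apply Rmult_le_pos; [lra|apply pow2_ge_0]).
  assert (hcd : 0 < c1 * d / 4) by nra.
  assert (k3 : 0 <= c1 * d / 4 * xi3 ^ 2)
    by (apply Rmult_le_pos; [lra|apply pow2_ge_0]).
  assert (e3 : xi3 ^ 2 = 0) by (apply (Rmult_eq_reg_l (c1 * d / 4)); lra).
  assert (e2 : sat (z2 c1 xi) ^ 2 = 0) by (apply (Rmult_eq_reg_l c1); lra).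
  assert (eg : V_partial3 c1 d xi = 0)
    by (apply mul_sat_eq0, (Rmult_eq_reg_l c2); lra).
  assert (e3' : xi3 = 0) by nra. clear e3. rename e3' into e3.
  assert (e2'' : sat (z2 c1 xi) = 0) by nra. clear e2. rename e2'' into e2.
  assert (e2' : z2 c1 xi = 0) by (apply mul_sat_eq0; rewrite e2; ring).
  unfold V_partial3, g in eg. rewrite e2, e2' in eg. simpl z3 in eg. rewrite e3 in eg.
  assert (hdc1 : 0 < d / c1) by (apply Rdiv_lt_0_compat; lra).
  assert (e1 : sat (z1 c1 d xi) = 0) by nra.
  assert (e1' : z1 c1 d xi = 0) by (apply mul_sat_eq0; rewrite e1; ring).
  simpl in e1', e2'. rewrite e3 in e1', e2'.
  assert (hx2 : xi2 = 0) by nra.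
  rewrite hx2 in e1'.
  assert (hx1 : d * c1 * xi1 = 0) by nra.
  assert (0 < d * c1) by nra.
  apply hxi. unfold xi. rewrite e3, hx2. repeat f_equal. nra.
Qed.

(** * Derivatives of the Lyapunov function in the AMB state *)

(** Stated along an arbitrary curve so that one chain-rule computation yields all three partial
    derivatives. *)
Lemma is_derive_V_curve (c1 d : R) (y1 y2 y3 : R -> R) (t l1 l2 l3 : R) :
  is_derive y1 t l1 -> is_derive y2 t l2 -> is_derive y3 t l3 ->
  is_derive (fun s => 4 * U (y2 s) (y3 s) + 2 * U (y2 s) (y3 s) ^ 2
               - d / 2 * y2 s * y3 s + RInt sat 0 (y1 s)) t
    (sat (y1 t) * l1
     + (4 * (1 + U (y2 t) (y3 t)) * sat (y2 t) - d / 2 * y3 t) * l2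
     + (4 * (1 + U (y2 t) (y3 t)) * y3 t - d / 2 * y2 t) * l3).
Proof.
  intros h1 h2 h3.
  apply (is_derive_ext (fun s =>
    4 * (y3 s ^ 2 / 2 + sat_primitive (y2 s))
    + 2 * (y3 s ^ 2 / 2 + sat_primitive (y2 s)) ^ 2
    - d / 2 * y2 s * y3 s + sat_primitive (y1 s))).
  { intros s. now rewrite U_eq, RInt_sat. }
  rewrite !U_eq.
  assert (p1 := is_derive_sat_primitive (y1 t)).
  assert (p2 := is_derive_sat_primitive (y2 t)).
  auto_derive.
  - repeat match goal with |- _ /\ _ => split end; try exact I; eexists; eassumption.
  - change (fun x => sat_primitive x) with sat_primitive.
    change (fun x => y1 x) with y1. change (fun x => y2 x) with y2.
    change (fun x => y3 x) with y3.
    rewrite (is_derive_unique _ _ _ h1), (is_derive_unique _ _ _ h2),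
      (is_derive_unique _ _ _ h3), (is_derive_unique _ _ _ p1), (is_derive_unique _ _ _ p2).
    field.
Qed.

(** This derivative is the denominator of [amb_control], which is why [X3] evolves with speed [mu]
    in closed loop. *)
Lemma is_derive_X3 (b0 b1 t : R) : is_derive (X3 b0 b1) t (b0 + 2 * b1 * Rabs t).
Proof.
  apply (is_derive_ext (fun s => b0 * s + b1 * signed_square s)).
  { intros s. unfold X3, signed_square. simpl. ring. }
  assert (h := is_derive_signed_square t).
  auto_derive.
  - eexists; exact h.
  - change (fun x => signed_square x) with signed_square.
    rewrite (is_derive_unique _ _ _ h). ring.
Qed.

Definition amb_coord (b0 b1 : R) (x : R3) : R3 :=
  let '(x1, x2, x3) := x in (x1, x2, X3 b0 b1 x3).

Lemma is_derive_amb_clf (b0 b1 c1 d x1 x2 x3 : R) :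
  0 < c1 ->
  let xi := amb_coord b0 b1 (x1, x2, x3) in
  is_derive (fun t => amb_clf b0 b1 c1 d (t, x2, x3)) x1 (V_partial1 c1 d xi) /\
  is_derive (fun t => amb_clf b0 b1 c1 d (x1, t, x3)) x2 (V_partial2 c1 d xi) /\
  is_derive (fun t => amb_clf b0 b1 c1 d (x1, x2, t)) x3
    (V_partial3 c1 d xi * (b0 + 2 * b1 * Rabs x3)).
Proof.
  intros hc xi.
  assert (hX := is_derive_X3 b0 b1 x3).
  split; [|split].
  (* The derivative is left open, to be fixed by the slopes of [z1], [z2], [z3] along the axis, and
     is compared with the closed form at the end. *)
  - evar (l : R). replace (V_partial1 c1 d xi) with l; [unfold l; apply
      (is_derive_V_curve c1 d (fun t => z1 c1 d (t, x2, X3 b0 b1 x3))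
        (fun t => z2 c1 (t, x2, X3 b0 b1 x3)) (fun t => X3 b0 b1 x3) x1 (d * c1) 0 0)|].
    + unfold z1. auto_derive; [exact I|ring].
    + unfold z2. auto_derive; [exact I|ring].
    + auto_derive; [exact I|ring].
    + unfold l, V_partial1. simpl. ring.
  - evar (l : R). replace (V_partial2 c1 d xi) with l; [unfold l; apply
      (is_derive_V_curve c1 d (fun t => z1 c1 d (x1, t, X3 b0 b1 x3))
        (fun t => z2 c1 (x1, t, X3 b0 b1 x3)) (fun t => X3 b0 b1 x3) x2 d c1 0)|].
    + unfold z1. auto_derive; [exact I|ring].
    + unfold z2. auto_derive; [exact I|ring].
    + auto_derive; [exact I|ring].
    + unfold l, V_partial2. simpl. ring.
  - set (k := b0 + 2 * b1 * Rabs x3) in *.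
    evar (l : R). replace (V_partial3 c1 d xi * k) with l; [unfold l; apply
      (is_derive_V_curve c1 d (fun t => z1 c1 d (x1, x2, X3 b0 b1 t))
        (fun t => z2 c1 (x1, x2, X3 b0 b1 t)) (fun t => X3 b0 b1 t) x3 (d / c1 * k) k k)|].
    + unfold z1. auto_derive; [eexists; exact hX|].
      change (fun x => X3 b0 b1 x) with (X3 b0 b1).
      rewrite (is_derive_unique _ _ _ hX). field. lra.
    + unfold z2. auto_derive; [eexists; exact hX|].
      change (fun x => X3 b0 b1 x) with (X3 b0 b1).
      rewrite (is_derive_unique _ _ _ hX). ring.
    + exact hX.
    + unfold l, V_partial3, g. simpl. field. lra.
Qed.

Lemma amb_clf_partials (b0 b1 c1 d : R) (x : R3) :
  0 < c1 ->
  let xi := amb_coord b0 b1 x in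
  partial1 (amb_clf b0 b1 c1 d) x = V_partial1 c1 d xi /\
  partial2 (amb_clf b0 b1 c1 d) x = V_partial2 c1 d xi /\
  partial3 (amb_clf b0 b1 c1 d) x = V_partial3 c1 d xi * (b0 + 2 * b1 * Rabs (snd x)).
Proof.
  destruct x as [[x1 x2] x3]. intros hc.
  destruct (is_derive_amb_clf b0 b1 c1 d x1 x2 x3 hc) as (h1 & h2 & h3).
  split; [|split]; apply is_derive_unique; assumption.
Qed.

(** * Continuity of the partial derivatives *)

Section ContinuousR.
Context {T : UniformSpace}.
Implicit Types f h : T -> R.

Lemma continuous_Rplus f h (x : T) :
  continuous f x -> continuous h x -> continuous (fun y => f y + h y) x.
Proof. exact (continuous_plus (V := R_NormedModule) f h x). Qed.

Lemma continuous_Rminus f h (x : T) :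
  continuous f x -> continuous h x -> continuous (fun y => f y - h y) x.
Proof. exact (continuous_minus (V := R_NormedModule) f h x). Qed.

Lemma continuous_Rmult f h (x : T) :
  continuous f x -> continuous h x -> continuous (fun y => f y * h y) x.
Proof. exact (continuous_mult (K := R_AbsRing) f h x). Qed.

End ContinuousR.

Ltac continuity_R :=
  repeat first
    [ apply continuous_const
    | assumption
    | apply continuous_Rminus
    | apply continuous_Rplus
    | apply continuous_Rmult ].

Lemma amb_clf_continuously_differentiable (b0 b1 c1 d : R) :
  0 < c1 -> continuously_differentiable (amb_clf b0 b1 c1 d).
Proof.
  intros hc. split.
  { intros x1 x2 x3.
    destruct (is_derive_amb_clf b0 b1 c1 d x1 x2 x3 hc) as (h1 & h2 & h3).
    split; [|split]; eexists; eassumption. }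
  intros x.
  assert (k1 : continuous (fun y : R3 => fst (fst y)) x).
  { apply continuous_comp; destruct x as [[x1 x2] x3]; apply continuous_fst. }
  assert (k2 : continuous (fun y : R3 => snd (fst y)) x).
  { apply (continuous_comp fst snd); destruct x as [[x1 x2] x3];
      [apply continuous_fst|apply continuous_snd]. }
  assert (k3 : continuous (fun y : R3 => snd y) x).
  { destruct x as [[x1 x2] x3]. apply continuous_snd. }
  assert (kabs : continuous (fun y : R3 => Rabs (snd y)) x).
  { apply (continuous_comp snd Rabs); [exact k3|apply continuous_Rabs]. }
  assert (kz3 : continuous (fun y : R3 => z3 (amb_coord b0 b1 y)) x).
  { apply (continuous_ext (fun y : R3 => X3 b0 b1 (snd y))).
    { now intros [[y1 y2] y3]. }
    apply (continuous_comp snd (X3 b0 b1)); [exact k3|].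
    apply (ex_derive_continuous (V := R_NormedModule)).
    eexists; apply is_derive_X3. }
  assert (kz2 : continuous (fun y : R3 => z2 c1 (amb_coord b0 b1 y)) x).
  { apply (continuous_ext (fun y : R3 => c1 * snd (fst y) + z3 (amb_coord b0 b1 y))).
    { now intros [[y1 y2] y3]. }
    continuity_R. }
  assert (kz1 : continuous (fun y : R3 => z1 c1 d (amb_coord b0 b1 y)) x).
  { apply (continuous_ext (fun y : R3 =>
      d * (c1 * fst (fst y) + snd (fst y)) + d / c1 * z3 (amb_coord b0 b1 y))).
    { now intros [[y1 y2] y3]. }
    continuity_R. }
  assert (ks1 : continuous (fun y : R3 => sat (z1 c1 d (amb_coord b0 b1 y))) x).
  { apply (continuous_comp _ sat); [exact kz1|apply continuous_sat]. }
  assert (ks2 : continuous (fun y : R3 => sat (z2 c1 (amb_coord b0 b1 y))) x).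
  { apply (continuous_comp _ sat); [exact kz2|apply continuous_sat]. }
  assert (kU : continuous
    (fun y : R3 => U (z2 c1 (amb_coord b0 b1 y)) (z3 (amb_coord b0 b1 y))) x).
  (* The integral is replaced by its differentiable closed form and the square by a product, which
     the continuity rules cover. *)
  { apply (continuous_ext (fun y : R3 =>
      / 2 * (z3 (amb_coord b0 b1 y) * z3 (amb_coord b0 b1 y))
      + sat_primitive (z2 c1 (amb_coord b0 b1 y)))).
    { intros y. rewrite U_eq. simpl. field. }
    apply continuous_Rplus; [continuity_R|].
    apply (continuous_comp _ sat_primitive); [exact kz2|].
    apply (ex_derive_continuous (V := R_NormedModule)).
    eexists; apply is_derive_sat_primitive. }
  split; [|split].
  - apply (continuous_ext (fun y => V_partial1 c1 d (amb_coord b0 b1 y))).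
    { intros y. symmetry. destruct (amb_clf_partials b0 b1 c1 d y hc) as (e1 & e2 & e3).
      exact e1. }
    unfold V_partial1. continuity_R.
  - apply (continuous_ext (fun y => V_partial2 c1 d (amb_coord b0 b1 y))).
    { intros y. symmetry. destruct (amb_clf_partials b0 b1 c1 d y hc) as (e1 & e2 & e3).
      exact e2. }
    unfold V_partial2. continuity_R.
  - apply (continuous_ext (fun y =>
      V_partial3 c1 d (amb_coord b0 b1 y) * (b0 + 2 * b1 * Rabs (snd y)))).
    { intros y. symmetry. destruct (amb_clf_partials b0 b1 c1 d y hc) as (e1 & e2 & e3).
      exact e3. }
    unfold V_partial3, g. continuity_R.
Qed.

(** * Radial unboundedness *)

(** The two summands of [X3] have the same sign, so their absolute values add. Hence [X3] is proper
    and vanishes only at 0. *)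
Lemma Rabs_le_Rabs_X3 (b0 b1 t : R) :
  0 < b0 -> 0 < b1 -> b0 * Rabs t <= Rabs (X3 b0 b1 t).
Proof.
  intros h0 h1. unfold X3.
  replace (b0 * t + b1 * t * Rabs t) with (t * (b0 + b1 * Rabs t)) by ring.
  assert (hp := Rabs_pos t).
  rewrite Rabs_mult, (Rabs_pos_eq (b0 + b1 * Rabs t)) by nra.
  assert (0 <= b1 * (Rabs t * Rabs t)) by (apply Rmult_le_pos; nra).
  nra.
Qed.

Lemma amb_clf_eq (b0 b1 c1 d : R) (x : R3) :
  amb_clf b0 b1 c1 d x = V c1 d (amb_coord b0 b1 x).
Proof. now destruct x as [[x1 x2] x3]. Qed.

Lemma norm_prod_le_plus (V1 V2 : NormedModule R_AbsRing) (a : V1) (b : V2) :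
  norm (a, b) <= norm a + norm b.
Proof.
  assert (ha := norm_ge_0 a). assert (hb := norm_ge_0 b).
  change (norm (a, b)) with (sqrt (norm a ^ 2 + norm b ^ 2)).
  rewrite <- (sqrt_pow2 (norm a + norm b)) by lra.
  apply sqrt_le_1_alt. nra.
Qed.

Lemma norm_R3_le (x1 x2 x3 : R) :
  norm ((x1, x2, x3) : R3) <= Rabs x1 + Rabs x2 + Rabs x3.
Proof.
  assert (n1 := norm_prod_le_plus _ R_NormedModule (x1, x2) x3).
  assert (n2 := norm_prod_le_plus R_NormedModule R_NormedModule x1 x2).
  apply Rle_trans with (1 := n1). apply Rplus_le_compat; [exact n2|apply Rle_refl].
Qed.

(** By contraposition: a bound on [V] bounds [z1], [z2], [z3], and the triangular change of
    coordinates then bounds [x3], [x2], [x1] in this order. *)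
Lemma amb_clf_radially_unbounded (b0 b1 c1 d : R) :
  0 < b0 -> 0 < b1 -> 0 < c1 -> 0 < d <= 4 / 3 ->
  radially_unbounded (amb_clf b0 b1 c1 d).
Proof.
  intros h0 h1 hc hd M.
  set (K := Rabs M + 1).
  (* [K] bounds each of [z1], [z2], [z3]. The radii come from [b0 * Rabs x3 <= Rabs z3], from
     [c1 * x2 = z2 - z3] and from [c1 * x1 = (z1 - d / c1 * z3) / d - x2]. *)
  set (k3 := K / b0). set (k2 := 2 * K / c1).
  set (k1 := ((K + d / c1 * K) / d + k2) / c1).
  exists (k1 + k2 + k3).
  intros [[x1 x2] x3] hx. rewrite amb_clf_eq.
  apply Rnot_le_lt. intros hM. apply (Rlt_not_le _ _ hx).
  assert (hV := V_lower_bound c1 d (amb_coord b0 b1 (x1, x2, x3)) hd).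
  set (xi := amb_coord b0 b1 (x1, x2, x3)) in *.
  assert (hp1 := Rabs_le_sat_primitive (z1 c1 d xi)).
  assert (hp2 := Rabs_le_sat_primitive (z2 c1 xi)).
  assert (hq1 := sat_primitive_ge0 (z1 c1 d xi)).
  assert (hq2 := sat_primitive_ge0 (z2 c1 xi)).
  assert (hMM := Rle_abs M).
  assert (b3 : Rabs (z3 xi) <= K).
  (* The square yields [Rabs z3 <= z3 ^ 2 / 2 + / 2], the analogue for [z3] of
     [Rabs_le_sat_primitive]. *)
  { unfold K. assert (0 <= (Rabs (z3 xi) - 1) ^ 2) by apply pow2_ge_0.
    rewrite <- (pow2_abs (z3 xi)) in hV. nra. }
  assert (b2 : Rabs (z2 c1 xi) <= K) by (unfold K; nra).
  assert (b1' : Rabs (z1 c1 d xi) <= K) by (unfold K; nra).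
  assert (b3x : Rabs x3 <= k3).
  { unfold k3. apply Rle_div_r; [lra|].
    assert (hX := Rabs_le_Rabs_X3 b0 b1 x3 h0 h1). simpl in b3. lra. }
  assert (hK : 0 < K) by (assert (h := Rabs_pos M); unfold K; lra).
  apply Rabs_le_between in b3. apply Rabs_le_between in b2. apply Rabs_le_between in b1'.
  assert (b2x : Rabs x2 <= k2).
  { unfold k2. apply Rle_div_r; [lra|].
    rewrite <- (Rabs_pos_eq c1) at 1 by lra. rewrite <- Rabs_mult.
    apply Rabs_le. simpl in b2, b3. lra. }
  assert (b1x : Rabs x1 <= k1).
  { unfold k1. apply Rle_div_r; [lra|].
    rewrite <- (Rabs_pos_eq c1) at 1 by lra. rewrite <- Rabs_mult.
    replace (x1 * c1) with ((z1 c1 d xi - d / c1 * z3 xi) / d - x2) by (simpl; field; lra).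
    assert (hdc : 0 < d / c1) by (apply Rdiv_lt_0_compat; lra).
    apply Rle_trans with (1 := Rabs_triang _ _). rewrite Rabs_Ropp.
    apply Rplus_le_compat; [|exact b2x].
    rewrite Rabs_div, (Rabs_pos_eq d) by lra.
    apply Rmult_le_compat_r; [apply Rlt_le, Rinv_0_lt_compat; lra|].
    apply Rabs_le. split; nra. }
  apply Rle_trans with (1 := norm_R3_le x1 x2 x3). lra.
Qed.

(** * Lyapunov property, amplitude bound and conclusion *)

(** Back substitution in a triangular system, [X3] being zero only at 0. It serves both the zero set
    of the Lyapunov function and the strict decrease off the origin. *)
Lemma coord_eq0 (b0 b1 c1 d : R) (x : R3) :
  0 < b0 -> 0 < b1 -> 0 < c1 -> 0 < d ->
  z1 c1 d (amb_coord b0 b1 x) = 0 -> z2 c1 (amb_coord b0 b1 x) = 0 ->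
  z3 (amb_coord b0 b1 x) = 0 -> x = (0, 0, 0).
Proof.
  destruct x as [[x1 x2] x3]. intros h0 h1 hc hd e1 e2 e3. simpl in e1, e2, e3.
  rewrite e3 in e1, e2.
  assert (hX := Rabs_le_Rabs_X3 b0 b1 x3 h0 h1). rewrite e3, Rabs_R0 in hX.
  assert (f3 : x3 = 0).
  { apply Rabs_eq_0. assert (h := Rabs_pos x3). nra. }
  assert (f2 : x2 = 0) by nra.
  rewrite f2 in e1.
  assert (0 < d * c1) by nra.
  assert (f1 : x1 = 0) by nra.
  now rewrite f1, f2, f3.
Qed.

Lemma amb_lyapunov (b0 b1 c1 c2 d : R) :
  0 < b0 -> 0 < b1 -> admissible c1 c2 d ->
  lyapunov_for (amb b0 b1) (amb_control b0 b1 c1 c2 d) (amb_clf b0 b1 c1 d).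
Proof.
  intros h0 h1 (hc & hc2 & hd0 & hdm).
  assert (hd : 0 < d <= 4 / 3).
  { split; [assumption|]. apply Rle_trans with (1 := hdm), Rmin_l. }
  assert (hdc : d <= c1) by (apply Rle_trans with (1 := hdm), Rmin_r).
  assert (origin : amb_coord b0 b1 (0, 0, 0) = (0, 0, 0)).
  { simpl. unfold X3. repeat f_equal. ring. }
  assert (P0 : sat_primitive 0 = 0) by (destruct (satP 0); lra).
  assert (lower : forall x, let xi := amb_coord b0 b1 x in
    0 <= z3 xi ^ 2 /\ 0 <= sat_primitive (z2 c1 xi) /\ 0 <= sat_primitive (z1 c1 d xi) /\
    z3 xi ^ 2 / 2 + sat_primitive (z2 c1 xi) + sat_primitive (z1 c1 d xi)
    <= amb_clf b0 b1 c1 d x).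
  { intros x xi. rewrite amb_clf_eq.
    split; [apply pow2_ge_0|split; [apply sat_primitive_ge0|split;
      [apply sat_primitive_ge0|now apply V_lower_bound]]]. }
  split; [now apply amb_clf_continuously_differentiable|].
  split; [intros x; destruct (lower x) as (l1 & l2 & l3 & l4); lra|].
  split; [now apply amb_clf_radially_unbounded|].
  split.
  { intros x. split.
    - intros hx. destruct (lower x) as (l1 & l2 & l3 & l4). rewrite hx in l4.
      apply (coord_eq0 b0 b1 c1 d); try assumption.
      + apply sat_primitive_eq0. lra.
      + apply sat_primitive_eq0. lra.
      + assert (e : z3 (amb_coord b0 b1 x) ^ 2 = 0) by lra. nra.
    - intros ->. rewrite amb_clf_eq, origin. unfold V. rewrite RInt_sat, U_eq.
      unfold z1, z2, z3.
      replace (d * (c1 * 0 + 0) + d / c1 * 0) with 0 by ring.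
      replace (c1 * 0 + 0) with 0 by ring. rewrite P0. field. }
  (* The factor [b0 + 2 * b1 * Rabs x3] in the third partial derivative cancels the denominator of
     the control, leaving the triple-integrator expression. *)
  assert (along : forall x1 x2 x3, let xi := (x1, x2, X3 b0 b1 x3) in
    Wdot (amb b0 b1) (amb_control b0 b1 c1 c2 d) (amb_clf b0 b1 c1 d) (x1, x2, x3)
    = V_partial1 c1 d xi * x2 + V_partial2 c1 d xi * X3 b0 b1 x3
      + V_partial3 c1 d xi * mu c1 c2 d xi).
  { intros x1 x2 x3 xi. unfold Wdot, amb, amb_control.
    destruct (amb_clf_partials b0 b1 c1 d (x1, x2, x3) hc) as (-> & -> & ->).
    change (amb_coord b0 b1 (x1, x2, x3)) with xi.
    change (b0 * x3 + b1 * x3 * Rabs x3) with (X3 b0 b1 x3). simpl snd.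
    fold xi. assert (ha := Rabs_pos x3).
    assert (0 < b0 + 2 * b1 * Rabs x3) by nra. field. lra. }
  split.
  - rewrite along.
    assert (e : X3 b0 b1 0 = 0) by (unfold X3; ring). rewrite e.
    assert (hm : mu c1 c2 d (0, 0, 0) = 0).
    { unfold mu, g, z1, z2, z3. rewrite U_eq.
      replace (d * (c1 * 0 + 0) + d / c1 * 0) with 0 by ring.
      replace (c1 * 0 + 0) with 0 by ring. rewrite sat_zero, P0.
      match goal with |- context [sat ?a] => replace a with 0 by (field; lra) end.
      rewrite sat_zero. ring. }
    rewrite hm. ring.
  - intros [[x1 x2] x3] hx. rewrite along.
    apply V_decrease_strict; try assumption.
    intros exi. apply hx.
    apply (coord_eq0 b0 b1 c1 d); try assumption;
      change (amb_coord b0 b1 (x1, x2, x3)) with (x1, x2, X3 b0 b1 x3);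
      rewrite exi; simpl; ring.
Qed.

(** The two saturations bound the numerator by [c1 + c2], and the denominator is at least [b0]. *)
Lemma amb_control_bound (b0 b1 c1 c2 d : R) (x : R3) :
  0 < b0 -> 0 < b1 -> 0 < c1 -> 0 < c2 ->
  Rabs (amb_control b0 b1 c1 c2 d x) <= (c1 + c2) / b0.
Proof.
  intros h0 h1 hc1 hc2. destruct x as [[x1 x2] x3].
  unfold amb_control, mu.
  match goal with |- context [- c1 * sat ?a - c2 * sat ?b] =>
    assert (ha := sat_Rabs_le a); assert (hb := sat_Rabs_le b);
    set (s := sat a) in *; set (t := sat b) in * end.
  apply Rabs_le_between in ha. apply Rabs_le_between in hb.
  assert (hp := Rabs_pos x3).
  assert (hk : 0 <= b1 * Rabs x3) by nra.
  rewrite Rabs_div by lra. rewrite (Rabs_pos_eq (b0 + _)) by lra.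
  assert (hn : Rabs (- c1 * s - c2 * t) <= c1 + c2) by (apply Rabs_le; split; nra).
  apply Rmult_le_compat; [apply Rabs_pos| |exact hn|].
  - apply Rlt_le, Rinv_0_lt_compat. lra.
  - apply Rinv_le_contravar; lra.
Qed.

Theorem theorem4 (beta0 beta1 : R) (hbeta0 : 0 < beta0) (hbeta1 : 0 < beta1) :
  (forall c1 c2 delta : R, admissible c1 c2 delta ->
     GAS (amb beta0 beta1) (amb_control beta0 beta1 c1 c2 delta) /\
     CLF (amb beta0 beta1) (amb_clf beta0 beta1 c1 delta)) /\
  (forall eps : R, 0 < eps ->
     exists c1 c2 delta : R, admissible c1 c2 delta /\
       forall x : R3, Rabs (amb_control beta0 beta1 c1 c2 delta x) <= eps).
Proof.
  split.
  - intros c1 c2 delta hadm.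
    assert (hL := amb_lyapunov beta0 beta1 c1 c2 delta hbeta0 hbeta1 hadm).
    (* The same fact supplies the Lyapunov function as witness for [GAS] and the feedback as witness
       for [CLF]. *)
    split; eexists; exact hL.
  - intros eps heps.
    (* With [c1 = c2 = c] the amplitude bound [(c1 + c2) / beta0] is exactly [eps]; [delta] is then
       taken as large as admissibility allows. *)
    set (c := eps * beta0 / 2).
    assert (hc : 0 < c) by (unfold c; nra).
    exists c, c, (Rmin (4 / 3) c). split.
    + repeat split; try assumption.
      * apply Rmin_pos; lra.
      * apply Rle_refl.
    + intros x. replace eps with ((c + c) / beta0) by (unfold c; field; lra).
      now apply amb_control_bound.
Qed.
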